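(* Let $\phi$ be an $\mathrm{MTL}^{\downarrow}$ formula, $\mu$ a partial valuation, $\nu$ a total valuation, $u$ an observation, $v$ a timed word, and $\tau\in\mathbb{Q}_{\geq 0}$. If $u\sqsubseteq v$ and $\mu\sqsubseteq\nu$, then $$\langle\!\langle u,\tau,\mu\models\phi\rangle\!\rangle \;\preceq\; [\![ v,\tau,\nu\models\phi]\!].$$
   Context: Fix a nonempty data domain $D$, a set $P$ of predicate symbols with arities $\iota(p)\in\mathbb{N}$, a set $R$ of registers, and a set $V$ of variables. $\mathrm{MTL}^{\downarrow}$ formulas are given by $\phi::=\mathsf{t}\mid p(\bar x)\mid \downarrow^{r}_{x}\phi\mid\neg\phi\mid\phi\vee\phi\mid\phi\,\mathsf{U}_I\,\phi$, where $p\in P$, $\bar x$ is a tuple of variables of length $\iota(p)$, $r\in R$, $x\in V$, and $I$ is an interval (a nonempty convex subset of $\mathbb{Q}_{\ge0}$). A (partial) valuation is a partial function $\nu:V\rightharpoonup D$; it is total if defined everywhere. For partial functions $f,g$, $f\sqsubseteq g$ means $\mathrm{def}(f)\subseteq\mathrm{def}(g)$ and $f(a)=g(a)$ for $a\in\mathrm{def}(f)$; $\nu[x\mapsto d]$ is the update, and if $d$ is undefined then $x\notin\mathrm{def}(\nu[x\mapsto d])$. $[\,]$ is the nowhere-defined function. Truth values: $\mathsf{3}=\{\mathsf{t},\mathsf{f},\bot\}$, with $\neg,\vee,\wedge,\rightarrow$ interpreted by strong Kleene logic ($\bot$ = unknown); the knowledge order $\preceq$ is the reflexive order with $\bot\prec\mathsf{t}$,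 $\bot\prec\mathsf{f}$, and $\mathsf{t},\mathsf{f}$ incomparable; $\mathsf{2}=\{\mathsf{t},\mathsf{f}\}$. Timed words: infinite sequences $(\tau_0,\sigma_0,\rho_0)(\tau_1,\sigma_1,\rho_1)\dots$ with $\tau_i\in\mathbb{Q}_{\ge0}$ strictly increasing and unbounded (nonzeno), $\sigma_i$ a total function on $P$ with $\sigma_i(p)\subseteq D^{\iota(p)}$, and $\rho_i:R\to D$ total. Boolean semantics for total $\nu$: $[\![w,i,\nu\models\mathsf{t}]\!]=\mathsf{t}$; $[\![w,i,\nu\models p(\bar x)]\!]=\mathsf{t}$ iff $\nu(\bar x)\in\sigma_i(p)$; $[\![w,i,\nu\models\downarrow^r_x\phi]\!]=[\![w,i,\nu[x\mapsto\rho_i(r)]\models\phi]\!]$; $\neg,\vee$ as usual; $[\![w,i,\nu\models\alpha\,\mathsf{U}_I\,\beta]\!]=\bigvee_{j:\tau_j-\tau_i\in I}\big([\![w,j,\nu\models\beta]\!]\wedge\bigwedge_{i\le k<j}[\![w,k,\nu\models\alpha]\!]\big)$. For $\tau\in\mathbb{Q}_{\ge0}$, $[\![w,\tau,\nu\models\phi]\!]=[\![w,j,\nu\models\phi]\!]$ if some $j$ has $\tau_j=\tau$, and $\bot$ otherwise. Observations: finite words $(I_0,\sigma_0,\rho_0)\dots(I_n,\sigma_n,\rho_n)$ with $I_i$ pairwise disjoint intervals ordered increasingly, $\sigma_i$ a partial function on $P$ with $\sigma_i(p)\subseteq D^{\iota(p)}$, and $\rho_i:R\rightharpoonup D$ partial,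 obtained from $([0,\infty),[\,],[\,])$ by finitely many transformations: (T1) split a letter $(J,[\,],[\,])$ with $\tau\in J$, $J$ not a singleton, into the letters $(J\cap[0,\tau),[\,],[\,])$, $(\{\tau\},[\,],[\,])$, $(J\cap(\tau,\infty),[\,],[\,])$, omitting those with empty interval; (T2) delete a letter whose interval is not a singleton; (T3) replace the interpretations $\sigma,\rho$ of a letter with singleton interval by $\sigma'\sqsupseteq\sigma$, $\rho'\sqsupseteq\rho$. Positions of $u$ are denoted $\mathit{pos}(u)$. For an observation $u$ and timed word $v$ (letters $(\tau_j,\sigma'_j,\rho'_j)$), $u\sqsubseteq v$ means there is $\pi:\mathbb{N}\to\mathit{pos}(u)$ with $\tau_j\in I_{\pi(j)}$, $\sigma_{\pi(j)}\sqsubseteq\sigma'_j$, $\rho_{\pi(j)}\sqsubseteq\rho'_j$ for all $j$, and every position of $u$ with a singleton interval lies in the image of $\pi$. Three-valued semantics on an observation $w$ with letters $(I_i,\sigma_i,\rho_i)$ and partial $\nu$: $\langle\!\langle w,i,\nu\models\mathsf{t}\rangle\!\rangle=\mathsf{t}$; $\langle\!\langle w,i,\nu\models p(\bar x)\rangle\!\rangle$ is $\mathsf{t}$ (resp. $\mathsf{f}$) if all variables of $\bar x$ are in $\mathrm{def}(\nu)$, $p\in\mathrm{def}(\sigma_i)$ and $\nu(\bar x)\in\sigma_i(p)$ (resp. $\notin$), and $\bot$ otherwise; $\langle\!\langle w,i,\nu\models\downarrow^r_x\phi\rangle\!\rangle=\langle\!\langle w,i,\nu[x\mapsto\rho_i(r)]\models\phi\rangle\!\rangle$;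 $\neg,\vee$ via Kleene logic; $\langle\!\langle w,i,\nu\models\alpha\,\mathsf{U}_I\,\beta\rangle\!\rangle=\bigvee_{j\ge i}\big(\mathrm{tp}_w(j)\wedge\mathrm{tc}_{w,I}(i,j)\wedge\langle\!\langle w,j,\nu\models\beta\rangle\!\rangle\wedge\bigwedge_{i\le k<j}(\mathrm{tp}_w(k)\to\langle\!\langle w,k,\nu\models\alpha\rangle\!\rangle)\big)$, where $\mathrm{tp}_w(j)=\mathsf{t}$ if $I_j$ is a singleton and $\bot$ otherwise, and $\mathrm{tc}_{w,I}(i,j)$ is $\mathsf{t}$ if $\tau'-\tau''\in I$ for all $\tau''\in I_i,\tau'\in I_j$, $\mathsf{f}$ if $\tau'-\tau''\notin I$ for all such, and $\bot$ otherwise. Finally $\langle\!\langle w,\tau,\nu\models\phi\rangle\!\rangle=\langle\!\langle w,j,\nu\models\phi\rangle\!\rangle$ if some position $j$ has $I_j=\{\tau\}$, and $\bot$ otherwise. *)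

(* Defs.v *)
From mathcomp Require Import all_boot all_order all_algebra.
From mathcomp Require Import boolp classical_sets.
From mathcomp Require Import num_normedtype.

Set Implicit Arguments.
Unset Strict Implicit.
Unset Printing Implicit Defensive.

Import Order.TTheory GRing.Theory Num.Theory.

Local Open Scope classical_set_scope.
Local Open Scope ring_scope.

(** * Partial functions *)

(* A partial function on [A] is an option-valued function: [None] is
   "undefined", and [as_partial f] views a total function as a partial one. *)
Definition undef A (B : A -> Type) : forall a, option (B a) := fun=> None.

Definition as_partial A (B : A -> Type) (f : forall a, B a) :
  forall a, option (B a) := fun a => Some (f a).

Definition pfun_le A (B : A -> Type) (f g : forall a, option (B a)) : Prop :=
  forall a b, f a = Some b -> g a = Some b.

(* Used both for total valuations ([T := D]) and for partial ones
   ([T := option D], where updating with [None] makes [x] undefined). *)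
Definition update (V T : Type) (nu : V -> T) (x : V) (d : T) : V -> T :=
  fun y => if `[< y = x >] then d else nu y.

(** * Strong Kleene logic *)

Inductive three : Set := TT | FF | UU.

Definition three_of_bool (b : bool) : three := if b then TT else FF.

Definition knot (a : three) : three :=
  match a with TT => FF | FF => TT | UU => UU end.

Definition kor (a b : three) : three :=
  match a, b with
  | TT, _ | _, TT => TT
  | FF, FF => FF
  | _, _ => UU
  end.

Definition kand (a b : three) : three :=
  match a, b with
  | FF, _ | _, FF => FF
  | TT, TT => TT
  | _, _ => UU
  end.

Definition kimp (a b : three) : three := kor (knot a) b.

Definition know_le (a b : three) : Prop := a = UU \/ a = b.

(** * Intervals *)

Definition nonneg : set rat := [set q | 0 <= q].

Definition interval_of (J : set rat) : Prop :=
  [/\ J !=set0, J `<=` nonneg & is_interval J].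

Record interval := Interval {
  interval_set :> set rat;
  intervalP : interval_of interval_set }.

Definition singleton (J : set rat) : Prop := exists t, J = [set t].

(** * Formulas *)

Inductive formula (P R V : Type) (iota : P -> nat) : Type :=
| Ftrue
| Fpred (p : P) (x : (iota p).-tuple V)
| Ffreeze (r : R) (x : V) (phi : formula R V iota)
| Fnot (phi : formula R V iota)
| For (phi psi : formula R V iota)
| Funtil (I : interval) (phi psi : formula R V iota).

(** * Timed words and their Boolean semantics *)

Record timed_word (D P R : Type) (iota : P -> nat) := TimedWord {
  tw_time : nat -> rat;
  tw_pred : nat -> forall p : P, set ((iota p).-tuple D);
  tw_reg : nat -> R -> D;
  tw_time_ge0 : forall i, 0 <= tw_time i;
  tw_time_lt : forall i j, (i < j)%N -> tw_time i < tw_time j;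
  tw_time_unbounded : forall q : rat, exists i, q < tw_time i }.

Arguments tw_pred {D P R iota} _ _ _ _.

Fixpoint bsem (D P R V : Type) (iota : P -> nat) (w : timed_word D R iota)
    (i : nat) (nu : V -> D) (phi : formula R V iota) : bool :=
  match phi with
  | Ftrue => true
  | Fpred p x => `[< tw_pred w i p (map_tuple nu x) >]
  | Ffreeze r x phi => bsem w i (update nu x (tw_reg w i r)) phi
  | Fnot phi => ~~ bsem w i nu phi
  | For phi psi => bsem w i nu phi || bsem w i nu psi
  | Funtil J phi psi =>
      `[< exists j, [/\ interval_set J (tw_time w j - tw_time w i),
            bsem w j nu psi
          & forall k, (i <= k < j)%N -> bsem w k nu phi] >]
  end.

(* The index [j] is unique, time being strictly increasing. *)
Definition bsem_at (D P R V : Type) (iota : P -> nat)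
    (w : timed_word D R iota) (tau : rat) (nu : V -> D)
    (phi : formula R V iota) : three :=
  match pselect (exists j, tw_time w j = tau) with
  | left e => three_of_bool (bsem w (projT1 (cid e)) nu phi)
  | right _ => UU
  end.

(** * Observations *)

Record letter (D P R : Type) (iota : P -> nat) := Letter {
  l_int : set rat;
  l_pred : forall p : P, option (set ((iota p).-tuple D));
  l_reg : R -> option D }.

Arguments Letter {D P R iota} _ _ _.
Arguments l_pred {D P R iota} _ _.

Definition blank (D P R : Type) (iota : P -> nat) (J : set rat) :
  letter D R iota := Letter J (@undef _ _) (@undef _ _).

Definition letter_at (D P R : Type) (iota : P -> nat)
    (u : seq (letter D R iota)) (i : 'I_(size u)) : letter D R iota :=
  tnth (in_tuple u) i.

Inductive observation (D P R : Type) (iota : P -> nat) :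
    seq (letter D R iota) -> Prop :=
| obs_init : observation [:: blank D R iota nonneg]
| obs_split u1 u2 (J : set rat) (tau : rat) of
    observation (u1 ++ blank D R iota J :: u2) & J tau & ~ singleton J :
    observation
      (u1 ++ [seq l <- [:: blank D R iota (J `&` [set` `[0, tau[]);
                           blank D R iota [set tau];
                           blank D R iota (J `&` [set` `]tau, +oo[])]
                | `[< l_int l !=set0 >]]
          ++ u2)
| obs_delete u1 u2 l of
    observation (u1 ++ l :: u2) & ~ singleton (l_int l) :
    observation (u1 ++ u2)
| obs_refine u1 u2 J sigma sigma' rho rho' of
    observation (u1 ++ Letter J sigma rho :: u2) & singleton J
    & pfun_le sigma sigma' & pfun_le rho rho' :
    observation (u1 ++ Letter J sigma' rho' :: u2).

(* [l_int l] is a bare set; the transformations nevertheless only produce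
   words whose letters carry intervals, disjoint and increasingly ordered. *)
Lemma observation_intervals (D P R : Type) (iota : P -> nat)
    (u : seq (letter D R iota)) (i j : 'I_(size u)) :
  observation u ->
  interval_of (l_int (letter_at i)) /\
  ((i < j)%N -> forall s t, l_int (letter_at i) s ->
                            l_int (letter_at j) t -> s < t).
Proof.
pose r (l l' : letter D R iota) :=
  `[< forall s t, l_int l s -> l_int l' t -> s < t >].
pose a (l : letter D R iota) := `[< interval_of (l_int l) >].
move=> uo; suff /andP[ua ur] : all a u && pairwise r u.
  have x0 := letter_at i; split=> [|ij].
    have /(all_nthP x0)/(_ i (ltn_ord i))/asboolP := ua.
    by rewrite /letter_at (tnth_nth x0).
  have /(pairwiseP x0)/(_ i j (ltn_ord i) (ltn_ord j) ij) := ur.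
  by rewrite /r /letter_at !(tnth_nth x0) => /asboolP.
elim: uo => {u i j}.
- rewrite /= !andbT; apply/asboolP; split=> //; first by exists 0 => /=.
  move=> x y; rewrite /nonneg /= => x0 y0 z /andP[xz _]; exact: le_trans xz.
- move=> u1 u2 J tau _ + Jtau _.
  set s := (X in u1 ++ X ++ u2).
  rewrite !all_cat !pairwise_cat !allrel_catr !allrel_consr pairwise_cons.
  rewrite [all a (_ :: _)]/=.
  move=> /andP[/and3P[a1 /asboolP[/= J0 Jge Ji] a2]].
  move=> /and3P[/andP[r1J r12] r1 /andP[rJ2 r2]].
  have subs (A : letter D R iota -> bool) :
      (forall K, K `<=` J -> K !=set0 -> is_interval K ->
         A (blank D R iota K)) -> all A s.
    move=> AK; rewrite /s all_filter /=.
    have I1 : is_interval (J `&` [set` `[0, tau[]).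
      move=> x y [Jx +] [Jy +] z /andP[xz zy]; rewrite /= !in_itv /=.
      move=> /andP[x0 _] /andP[_ yt]; split.
        by apply: Ji Jx Jy _ _; apply/andP.
      by rewrite (le_trans x0 xz) (le_lt_trans zy yt).
    have I2 : is_interval [set tau].
      by move=> x y -> -> z /le_anti ->.
    have I3 : is_interval (J `&` [set` `]tau, +oo[]).
      move=> x y [Jx +] [Jy +] z /andP[xz zy]; rewrite /= !in_itv /= !andbT.
      move=> tx _; split.
        by apply: Ji Jx Jy _ _; apply/andP.
      by rewrite (lt_le_trans tx xz).
    rewrite andbT.
    apply/and3P; split; apply/implyP => /asboolP K0; apply: AK => // q /=.
    by move=> ->.
  have sa : all a s.
    apply: subs => K KJ K0 Ki; apply/asboolP; split=> //=.
    exact: subset_trans Jge.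
  have rs : pairwise r s.
    apply: pairwise_filter; rewrite /= !andbT; apply/andP; split.
      apply/andP; split; apply/asboolP => x y /= [_]; rewrite in_itv /=.
        by move=> /andP[_ xt] ->.
      move=> /andP[_ xt] [_]; rewrite in_itv /= andbT; exact: lt_trans.
    by apply/asboolP => x y /= -> [_]; rewrite in_itv /= andbT.
  have r1s : allrel r u1 s.
    apply: sub_all r1J => l /asboolP rl; apply: subs => K KJ _ _.
    by apply/asboolP => x y lx /KJ; apply: rl.
  have rs2 : allrel r s u2.
    apply: subs => K KJ _ _; apply: sub_all rJ2 => l /asboolP rl.
    by apply/asboolP => x y /KJ; apply: rl.
  by rewrite a1 sa a2 r1s r12 r1 rs2 rs r2.
- move=> u1 u2 l _ + _; rewrite !all_cat !pairwise_cat !allrel_consr /=.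
  by move=> /andP[/and3P[-> _ ->] /and3P[/andP[_ ->] -> /andP[_ ->]]].
- move=> u1 u2 J sigma sigma' rho rho' _ + _ _ _.
  by rewrite !all_cat !pairwise_cat !allrel_consr /=.
Qed.

Definition obs_le (D P R : Type) (iota : P -> nat)
    (u : seq (letter D R iota)) (v : timed_word D R iota) : Prop :=
  exists pi : nat -> 'I_(size u),
    (forall j, let l := letter_at (pi j) in
       [/\ l_int l (tw_time v j),
           pfun_le (l_pred l) (as_partial (tw_pred v j))
         & pfun_le (l_reg l) (as_partial (tw_reg v j))]) /\
    (forall i, singleton (l_int (letter_at i)) ->
       exists j, pi j = i).

(** * Three-valued semantics *)

(* [Some] of the tuple of values if all the entries of [x] are in the domain
   of [nu], and [None] otherwise. *)
Definition peval (D V : Type) n (nu : V -> option D) (x : n.-tuple V) :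
  option (n.-tuple D) := insub (pmap nu x).

Section ThreeValued.
Context {D P R : Type} {iota : P -> nat} (u : seq (letter D R iota)).

Definition tp (j : 'I_(size u)) : three :=
  if `[< singleton (l_int (letter_at j)) >] then TT else UU.

Definition tc (I : interval) (i j : 'I_(size u)) : three :=
  if `[< forall s t, l_int (letter_at i) s -> l_int (letter_at j) t ->
           interval_set I (t - s) >] then TT
  else if `[< forall s t, l_int (letter_at i) s -> l_int (letter_at j) t ->
                ~ interval_set I (t - s) >] then FF
  else UU.

Fixpoint tsem {V : Type} (i : 'I_(size u)) (nu : V -> option D)
    (phi : formula R V iota) : three :=
  match phi with
  | Ftrue => TT
  | Fpred p x =>
      match peval nu x, l_pred (letter_at i) p with
      | Some d, Some A => three_of_bool `[< A d >]
      | _, _ => UU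
      end
  | Ffreeze r x phi => tsem i (update nu x (l_reg (letter_at i) r)) phi
  | Fnot phi => knot (tsem i nu phi)
  | For phi psi => kor (tsem i nu phi) (tsem i nu psi)
  | Funtil J phi psi =>
      \big[kor/FF]_(j < size u | (i <= j)%N)
        kand (tp j) (kand (tc J i j) (kand (tsem j nu psi)
          (\big[kand/TT]_(k < size u | (i <= k < j)%N)
             kimp (tp k) (tsem k nu phi))))
  end.

(* The position [j] is unique when [u] is an observation, its intervals being
   disjoint. *)
Definition tsem_at {V : Type} (tau : rat) (nu : V -> option D)
    (phi : formula R V iota) : three :=
  match [pick j : 'I_(size u) | `[< l_int (letter_at j) = [set tau] >]] with
  | Some j => tsem j nu phi
  | None => UU
  end.

End ThreeValued.

(* Main.v *)
Require Import Defs.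
From mathcomp Require Import all_boot all_order all_algebra.
From mathcomp Require Import boolp classical_sets.

Set Implicit Arguments.
Unset Strict Implicit.
Unset Printing Implicit Defensive.

Import Order.TTheory GRing.Theory Num.Theory.

Local Open Scope ring_scope.

(** By induction on the formula, the value at every position [pi j] of the
    observation, and not only at the singleton ones, is below the value at [j]
    in the timed word. The map [pi] is monotone, and injective above singleton
    positions. In the case of until, a witness or a counterexample provided by
    the observation is at a singleton position, by the [tp] guards, hence has a
    preimage under [pi] in the range of indices required by the Boolean
    semantics. *)

(** Splits the comparison into the two decided values, so that until can be treated separately for a
    witness and for a counterexample. *)
Lemma know_leP (a : three) (b : bool) :
  know_le a (three_of_bool b) <-> (a = TT -> b) /\ (a = FF -> ~~ b).
Proof.
split; first by case=> ->; split; case: b.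
case: a => -[aT aF]; last by left.
- by right; rewrite (aT erefl).
- by right; rewrite (negbTE (aF erefl)).
Qed.

Lemma know_le_not (a : three) (b : bool) :
  know_le a (three_of_bool b) -> know_le (knot a) (three_of_bool (~~ b)).
Proof. by case=> ->; [left | right; case: b]. Qed.

Lemma know_le_or (a a' : three) (b b' : bool) :
  know_le a (three_of_bool b) -> know_le a' (three_of_bool b') ->
  know_le (kor a a') (three_of_bool (b || b')).
Proof.
by move=> [|] -> [|] ->; case: b; case: b'; rewrite /know_le /=; auto.
Qed.

Lemma kand_eqTT a b : kand a b = TT -> a = TT /\ b = TT.
Proof. by case: a; case: b. Qed.

Lemma kand_eqFF a b : kand a b = FF -> a = FF \/ b = FF.
Proof. by case: a; case: b => //; auto. Qed.

Lemma kor_eqTT a b : kor a b = TT -> a = TT \/ b = TT.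
Proof. by case: a; case: b => //; auto. Qed.

Lemma kor_eqFF a b : kor a b = FF -> a = FF /\ b = FF.
Proof. by case: a; case: b. Qed.

Section BigKleene.
Variables (I : eqType) (P : pred I) (F : I -> three).

Lemma big_kor_eqTT (r : seq I) :
  \big[kor/FF]_(i <- r | P i) F i = TT -> exists2 i, P i & F i = TT.
Proof.
elim: r => [|i r IH]; first by rewrite big_nil.
rewrite big_cons; case: ifP => // Pi /kor_eqTT[Fi|]; last exact: IH.
by exists i.
Qed.

Lemma big_kor_eqFF (r : seq I) i :
  \big[kor/FF]_(i <- r | P i) F i = FF -> i \in r -> P i -> F i = FF.
Proof.
elim: r => //= k r IH; rewrite big_cons in_cons.
case: ifP => [Pk /kor_eqFF[Fk Fr] | Pk Fr] /orP[/eqP ->|ir] //; try exact: IH.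
by rewrite Pk.
Qed.

Lemma big_kand_eqTT (r : seq I) i :
  \big[kand/TT]_(i <- r | P i) F i = TT -> i \in r -> P i -> F i = TT.
Proof.
elim: r => //= k r IH; rewrite big_cons in_cons.
case: ifP => [Pk /kand_eqTT[Fk Fr] | Pk Fr] /orP[/eqP ->|ir] //; try exact: IH.
by rewrite Pk.
Qed.

Lemma big_kand_eqFF (r : seq I) :
  \big[kand/TT]_(i <- r | P i) F i = FF -> exists2 i, P i & F i = FF.
Proof.
elim: r => [|i r IH]; first by rewrite big_nil.
rewrite big_cons; case: ifP => // Pi /kand_eqFF[Fi|]; last exact: IH.
by exists i.
Qed.

End BigKleene.

(** For freeze: [e] may be [None], as when the register is unknown in the observation, and then
    nothing is asked of [d]. *)
Lemma pfun_le_update (D V : Type) (mu : V -> option D) (nu : V -> D) (x : V)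
    (e : option D) (d : D) :
  pfun_le mu (as_partial nu) -> (forall c, e = Some c -> c = d) ->
  pfun_le (update mu x e) (as_partial (update nu x d)).
Proof.
move=> mn ed y c; rewrite /update /as_partial.
by case: ifP => _ => [/ed ->|/mn].
Qed.

Lemma pmap_pfun_le (D V : Type) (mu : V -> option D) (nu : V -> D) (s : seq V) :
  pfun_le mu (as_partial nu) -> size (pmap mu s) = size s ->
  pmap mu s = map nu s.
Proof.
move=> mn; elim: s => //= x s IH; case E: (mu x) => [d|] /=.
  by have [->] := mn _ _ E => -[/IH ->].
(* [pmap] drops an undefined head, so the result is too short. *)
by move=> sz; have := count_size mu s; rewrite -size_pmap sz ltnn.
Qed.

Lemma peval_pfun_le (D V : Type) (mu : V -> option D) (nu : V -> D) n
    (x : n.-tuple V) (d : n.-tuple D) :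
  pfun_le mu (as_partial nu) -> peval mu x = Some d -> map_tuple nu x = d.
Proof.
move=> mn; rewrite /peval; case: insubP => // d' sz vd [<-].
apply: val_inj; rewrite vd /= (pmap_pfun_le mn) //.
by rewrite (eqP sz) size_tuple.
Qed.

Lemma tw_time_mono (D P R : Type) (iota : P -> nat) (v : timed_word D R iota) :
  {mono tw_time v : i j / (i <= j)%N >-> i <= j}.
Proof. by apply: le_mono => i j; apply: tw_time_lt. Qed.

Section Monotonicity.
Context {D P R V : Type} {iota : P -> nat}.
Variables (u : seq (letter D R iota)) (v : timed_word D R iota).
Hypothesis hu : observation u.
Variable pi : nat -> 'I_(size u).
Hypothesis pi_int : forall j, l_int (letter_at (pi j)) (tw_time v j).
Hypothesis pi_pred : forall j,
  pfun_le (l_pred (letter_at (pi j))) (as_partial (tw_pred v j)).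
Hypothesis pi_reg : forall j,
  pfun_le (l_reg (letter_at (pi j))) (as_partial (tw_reg v j)).
Hypothesis pi_onto : forall i, singleton (l_int (letter_at i)) ->
  exists j, pi j = i.

(** Otherwise the ordering of the intervals of [u] would put time [j] strictly before time [i]. *)
Lemma pi_le i j : (i <= j)%N -> (pi i <= pi j)%N.
Proof.
move=> ij; rewrite leqNgt; apply/negP => ji.
have [_ /(_ ji _ _ (pi_int j) (pi_int i))] :=
  observation_intervals (pi j) (pi i) hu.
by rewrite ltNge tw_time_mono ij.
Qed.

Lemma pi_lt i j : (pi i < pi j)%N -> (i < j)%N.
Proof. by rewrite !ltnNge; apply: contra => /pi_le. Qed.

Lemma pi_inj_singleton i j :
  singleton (l_int (letter_at (pi i))) -> pi i = pi j -> i = j.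
Proof.
move=> [t it] ij; apply: (inc_inj (@tw_time_mono _ _ _ _ v)).
have := pi_int j; have := pi_int i.
by rewrite -ij it => -> ->.
Qed.

(** Uniqueness of the preimage is what later separates positions at the two ends of an until range,
    [pi] being only weakly monotone. *)
Lemma tp_TT k : tp (u := u) k = TT -> exists2 j, pi j = k &
  forall i, pi i = k -> i = j.
Proof.
rewrite /tp; case: asboolP => // sk _; have [j jk] := pi_onto sk.
by exists j => // i ik; apply: pi_inj_singleton; rewrite ik.
Qed.

Lemma tc_TT I i j : tc (u := u) I (pi i) (pi j) = TT ->
  interval_set I (tw_time v j - tw_time v i).
Proof.
rewrite /tc; case: asboolP => [h _|_]; first exact: h.
by case: ifP.
Qed.

Lemma tc_FF I i j : tc (u := u) I (pi i) (pi j) = FF ->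
  ~ interval_set I (tw_time v j - tw_time v i).
Proof. by rewrite /tc; case: ifP => // _; case: asboolP => // h _; apply: h. Qed.

(** The Boolean until does not state [i <= j]; it follows because [I] has only nonnegative
    elements. *)
Lemma interval_time_le (I : Defs.interval) i j :
  interval_set I (tw_time v j - tw_time v i) -> (i <= j)%N.
Proof.
by have [_ I0 _] := intervalP I => /I0; rewrite /nonneg /= subr_ge0 tw_time_mono.
Qed.

Lemma tsem_le_bsem (phi : formula R V iota) (mu : V -> option D) (nu : V -> D)
    (i : nat) :
  pfun_le mu (as_partial nu) ->
  know_le (tsem (pi i) mu phi) (three_of_bool (bsem v i nu phi)).
Proof.
elim: phi mu nu i => [|p x|r x phi IH|phi IH|phi IHphi psi IHpsi
    |I phi IHphi psi IHpsi] mu nu i mn /=.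
- by right.
- case E: (peval mu x) => [d|]; last by left.
  case A: (l_pred _ _) => [S|]; last by left.
  by right; rewrite (peval_pfun_le mn E); have [->] := pi_pred A.
- apply/IH/pfun_le_update => // c /pi_reg[]; exact.
- exact/know_le_not/IH.
- by apply: know_le_or; [exact: IHphi | exact: IHpsi].
have phiP k := (know_leP _ _).1 (IHphi _ _ k mn).
have phiT k := (phiP k).1; have phiF k := (phiP k).2.
have psiP k := (know_leP _ _).1 (IHpsi _ _ k mn).
have psiT k := (psiP k).1; have psiF k := (psiP k).2.
apply/know_leP; split.
  move=> /big_kor_eqTT[j' ij' /kand_eqTT[/tp_TT[j jj' uniq_j]]].
  rewrite -{j'}jj' in ij' uniq_j *.
  move=> /kand_eqTT[/tc_TT cj /kand_eqTT[/psiT sj alln]].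
  apply/asboolP; exists j; split=> // k /andP[ik kj]; apply: phiT.
  have /(big_kand_eqTT alln) : pi k \in index_enum _ by rewrite mem_index_enum.
  (* The upper bound is strict because [pi k = pi j] would force [k = j]. *)
  have -> : (pi i <= pi k < pi j)%N.
    rewrite (pi_le ik) ltn_neqAle (pi_le (ltnW kj)) andbT.
    by apply/eqP => /val_inj/uniq_j kjE; rewrite kjE ltnn in kj.
  (* [tp] is never [FF], so the implication can only be true through its conclusion. *)
  by move=> /(_ isT)/kor_eqTT[|//]; rewrite /tp; case: ifP.
move=> allF; apply/asboolP => -[j [cj sj sk]].
have ij := interval_time_le cj.
(* A Boolean witness [j] makes the disjunct at [pi j] false; of its factors only the conjunction
   over [phi] can be to blame. *)
have := big_kor_eqFF allF (mem_index_enum (pi j)) (pi_le ij).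
case/kand_eqFF; first by rewrite /tp; case: ifP.
case/kand_eqFF; first by move/tc_FF.
case/kand_eqFF; first by move=> /psiF; rewrite sj.
move=> /big_kand_eqFF[k' /andP[ik kj] /kor_eqFF[tk]].
(* A false implication has a true premise, so the counterexample is at a singleton position. *)
have /tp_TT[k kk' uniq_k] : tp k' = TT by move: tk; case: (tp k').
rewrite -{k'}kk' in ik kj uniq_k tk * => /phiF/negP; apply.
(* If [k < i], monotonicity gives [pi k = pi i], hence [i = k] by uniqueness. *)
apply: sk; rewrite (pi_lt kj) andbT leqNgt; apply/negP => ki.
have /val_inj/uniq_k ikE : pi i = pi k :> nat.
  by apply/eqP; rewrite eqn_leq ik pi_le // ltnW.
by rewrite ikE ltnn in ki.
Qed.

End Monotonicity.

Theorem mainTheorem1 (D P R V : Type) (iota : P -> nat) (hD : inhabited D)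
    (phi : formula R V iota) (mu : V -> option D) (nu : V -> D)
    (u : seq (letter D R iota)) (hu : observation u)
    (v : timed_word D R iota) (tau : rat) (htau : 0 <= tau) :
  obs_le u v -> pfun_le mu (as_partial nu) ->
  know_le (tsem_at u tau mu phi) (bsem_at v tau nu phi).
Proof.
move=> [pi [pi_le pi_onto]] mn.
rewrite /tsem_at; case: pickP => [k /asboolP ktau|_]; last by left.
have [j jk] : exists j, pi j = k by apply: pi_onto; exists tau.
have jtau : tw_time v j = tau by have [+ _ _] := pi_le j; rewrite jk ktau.
rewrite /bsem_at; case: pselect => [e|]; last by case; exists j.
(* The index chosen by [cid] is [j], since time is strictly increasing. *)
have -> : projT1 (cid e) = j.
  by apply: (inc_inj (@tw_time_mono _ _ _ _ v)); rewrite (projT2 (cid e)).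
rewrite -jk; apply: tsem_le_bsem => // i; by have [] := pi_le i.
Qed.
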